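(* Let $S\subset\mathcal P$ be a rectangular lattice. Then every bounded region of the line pattern $\mathcal L_S$ is a polygon with at most $4$ sides (i.e. a triangle or a quadrilateral).
   Context: $\mathcal P=\mathbb{R}^2\setminus\{(0,0)\}$; for $P=(A,B)\in\mathcal P$, $L_P$ is the line $Ax+By=1$ in $\mathbb{R}^2$; $\mathcal L_S=\{L_P\mid P\in S\}$. A rectangular lattice is a set of the form $S=\{(a+k\delta_x,\,b+j\delta_y)\mid k,j\in\mathbb{Z},\ 0\le k\le N,\ 0\le j\le M\}\setminus\{(0,0)\}$, where $(a,b)\ne(0,0)$, $\delta_x,\delta_y>0$, $N,M\in\mathbb{Z}_{\ge0}$, and the corners $(a,b+M\delta_y)$, $(a+N\delta_x,b)$, $(a+N\delta_x,b+M\delta_y)$ are all different from $(0,0)$. The regions of $\mathcal L_S$ are the closures of the connected components of $\mathbb{R}^2\setminus\bigcup_{P\in S}L_P$. *)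

(* Defs.v *)
From mathcomp Require Import all_boot all_order all_algebra.
From mathcomp Require Import all_classical all_reals all_analysis.
Set Implicit Arguments. Unset Strict Implicit. Unset Printing Implicit Defensive.
Import Order.TTheory GRing.Theory Num.Theory numFieldTopology.Exports numFieldNormedType.Exports.
Local Open Scope classical_set_scope.
Local Open Scope ring_scope.

Definition lineP {R : realType} (P : R * R) : set (R * R) :=
  [set z | P.1 * z.1 + P.2 * z.2 = 1].

Definition rect_lattice {R : realType} (a b dx dy : R) (N M : nat) : set (R * R) :=
  [set p | (exists k j : nat, [/\ (k <= N)%N, (j <= M)%N &
              p = (a + k%:R * dx, b + j%:R * dy)]) /\ p <> (0, 0)].

Definition pattern_complement {R : realType} (S : set (R * R)) : set (R * R) :=
  ~` (\bigcup_(P in S) lineP P).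

Definition is_region {R : realType} (S : set (R * R)) (Rg : set (R * R)) : Prop :=
  exists2 x, pattern_complement S x &
    Rg = closure (connected_component (pattern_complement S) x).

Definition bounded_plane {R : realType} (A : set (R * R)) : Prop :=
  exists r : R, forall z, A z -> `|z.1| <= r /\ `|z.2| <= r.

Definition conv_hull {R : realType} (vs : seq (R * R)) : set (R * R) :=
  [set z | exists w : 'I_(size vs) -> R,
     [/\ (forall i, 0 <= w i), \sum_(i < size vs) w i = 1,
         z.1 = \sum_(i < size vs) w i * (nth (0, 0) vs i).1 &
         z.2 = \sum_(i < size vs) w i * (nth (0, 0) vs i).2]].

Definition side_line {R : realType} (Rg : set (R * R)) (P : R * R) : Prop :=
  exists z1 z2, [/\ Rg z1, Rg z2, lineP P z1, lineP P z2 & z1 <> z2].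

Definition polygon_at_most_4_sides {R : realType} (S : set (R * R))
  (Rg : set (R * R)) : Prop :=
  (exists vs : seq (R * R), (3 <= size vs <= 4)%N /\ Rg = conv_hull vs) /\
  (exists ps : seq (R * R), (size ps <= 4)%N /\
     forall P, S P -> side_line Rg P -> P \in ps).

(* Main.v *)
(* A point z gives every grid point P the sign of P.z - 1, and the closure of a component
   is the cell of all z inducing (weakly) a fixed labelling.  The midpoint of a side of the
   cell lying on the line of P is an affine functional that vanishes at P and has the correct
   strict sign at all other grid points; call such a P a facet.  If all labels agree, facets
   are corners of the grid.  Otherwise each label carries at most two facets: if P1, P2, P3
   are facets with one label and Q has the other, then Q lies in the wedge opposite to the
   triangle at one of them, say P2.  Choose such a Q with minimal barycentric coordinate at
   P2; then Q + P1 - P2 or Q + P3 - P2, or else a corner of the box spanned by P2 and Q, is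
   a grid point with the label of Q and a smaller coordinate.  So the cell has at most four
   sides, and, by double counting of incidences, at most four vertices. *)
Require Import Defs.
From mathcomp Require Import all_boot all_order all_algebra.
From mathcomp Require Import ring lra zify.
From mathcomp Require Import all_classical all_reals all_analysis.
Import Order.TTheory GRing.Theory Num.Theory numFieldTopology.Exports numFieldNormedType.Exports.
Local Open Scope classical_set_scope.
Local Open Scope ring_scope.

(** * Facets of a dichotomy of a grid *)

Lemma seq_arg_min (R : realDomainType) (T : eqType) (F : T -> R) (s : seq T) (A : pred T) :
  has A s -> exists x, [/\ x \in s, A x & forall y, y \in s -> A y -> F x <= F y].
Proof.
elim: s => // x s IH; have [hs _|hs] := boolP (has A s).
  have [y [ys Ay ymin]] := IH hs.
  have [Fxy|Fyx] := boolP (A x && (F x <= F y)).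
    case/andP: Fxy => Ax Fxy; exists x; split=> //; first by rewrite mem_head.
    move=> z; rewrite inE => /orP[/eqP->//|zs Az].
    exact: le_trans Fxy (ymin _ zs Az).
  exists y; split=> //; first by rewrite inE ys orbT.
  move=> z; rewrite inE => /orP[/eqP-> Ax|]; last exact: ymin.
  by move: Fyx; rewrite Ax /= -ltNge => /ltW.
rewrite /= (negbTE hs) orbF => Ax; exists x; split=> //; first exact: mem_head.
move=> z; rewrite inE => /orP[/eqP->//|zs Az].
by case/hasP: hs; exists z.
Qed.

Lemma mem_grid (T : eqType) (X Y : seq T) (p : T * T) :
  (p \in [seq (x, y) | x <- X, y <- Y]) = (p.1 \in X) && (p.2 \in Y).
Proof.
apply/allpairsP/andP => [[[x y] /= [xX yY ->]] //|[xX yY]].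
by exists p; rewrite -surjective_pairing.
Qed.

(** A point [z] acts on grid points through the triple [(z, -1)]; general triples also cover
    barycentric coordinates and negated functionals. *)
Definition aff {R : realType} (g : R * R * R) (p : R * R) : R :=
  g.1.1 * p.1 + g.1.2 * p.2 + g.2.

Definition between {R : realType} (x z y : R) : bool :=
  (x <= z <= y) || (y <= z <= x).

(** [x + y - z] is the reflection of [z] in the midpoint of [x] and [y]. When [z] lies between them,
    so does its image, which is why a finite progression can have this property. *)
Definition reflection_closed {R : realType} (X : seq R) : Prop :=
  forall x y z, x \in X -> y \in X -> z \in X -> between x z y -> x + y - z \in X.

(* [g] represents a point in the relative interior of the side of the cell on the line of
   [P], since strict signs at all other grid points put it on no other line. *)
Definition facet {R : realType} (B : seq (R * R)) (T : pred (R * R)) (P : R * R) : Prop :=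
  exists2 g, aff g P = 0 &
    forall p, p \in B -> p != P -> if T p then 0 < aff g p else aff g p < 0.

(** Here [p1] and [q] lie strictly on one side of [p2]. As [c1] is negative, its term points away
    from [q], so the [c3] term must point towards [q], which puts [p3] on the other side. *)
Lemma not_between_sign {R : realType} (c1 c3 p1 p2 p3 q : R) :
  c1 < 0 -> c3 < 0 -> q - p2 = c1 * (p1 - p2) + c3 * (p3 - p2) ->
  ~~ between p1 p2 q ->
  [/\ p2 < p1, p2 < q & p3 < p2] \/ [/\ p1 < p2, q < p2 & p2 < p3].
Proof.
move=> c1n c3n E; rewrite /between negb_or !negb_and -!ltNge.
case: (ltrgtP p1 p2) => [lt1|lt1|eq1] /=; case: (ltrgtP p2 q) => [lt2|lt2|eq2] //= _.
- right; split=> //; rewrite -subr_gt0; nra.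
- left; split=> //; rewrite -subr_lt0; nra.
Qed.

(** If [u * x] were nonnegative, the first inequality would make [v * y] positive; if [v * y] were
    nonnegative, the second would make [u * x] positive. Either way the third inequality fails. *)
Lemma linear_neg_quadrant {R : realType} (u v x1 y1 x3 y3 x y : R) :
  (x1 < 0 /\ 0 < x /\ 0 < x3 \/ 0 < x1 /\ x < 0 /\ x3 < 0) ->
  (y3 < 0 /\ 0 < y /\ 0 < y1 \/ 0 < y3 /\ y < 0 /\ y1 < 0) ->
  0 < u * x1 + v * y1 -> 0 < u * x3 + v * y3 -> u * x + v * y < 0 ->
  u * x < 0 /\ v * y < 0.
Proof.
move=> hx hy h1 h3 h; apply/andP; apply: contraT.
rewrite negb_and -!leNgt => /orP[] k; exfalso.
- case: hx => [[a [b c]]|[a [b c]]]; case: hy => [[d [e f]]|[d [e f]]].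
  + have ? : 0 <= u by nra.
    have ? : v < 0 by nra.
    nra.
  + have ? : 0 <= u by nra.
    have ? : 0 < v by nra.
    nra.
  + have ? : u <= 0 by nra.
    have ? : v < 0 by nra.
    nra.
  + have ? : u <= 0 by nra.
    have ? : 0 < v by nra.
    nra.
- case: hx => [[a [b c]]|[a [b c]]]; case: hy => [[d [e f]]|[d [e f]]].
  + have ? : 0 <= v by nra.
    have ? : u < 0 by nra.
    nra.
  + have ? : v <= 0 by nra.
    have ? : u < 0 by nra.
    nra.
  + have ? : 0 <= v by nra.
    have ? : 0 < u by nra.
    nra.
  + have ? : v <= 0 by nra.
    have ? : 0 < u by nra.
    nra.
Qed.

(** [c1], [c2], [c3] give the barycentric coordinates for the triangle. The proof is a descent: a
    [Q] minimal for [aff c2] is beaten by a grid point built from [Q], [P2] and possibly [P1] or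
    [P3]. *)
Lemma no_opposite_in_wedge (R : realType) (X Y : seq R) (T : pred (R * R))
    (P1 P2 P3 : R * R) (c1 c2 c3 : R * R * R) (Q : R * R) :
  let B := [seq (x, y) | x <- X, y <- Y] in
  reflection_closed X -> reflection_closed Y ->
  P1 \in B -> P2 \in B -> P3 \in B -> T P1 -> T P2 -> T P3 ->
  P1 != P2 -> P2 != P3 -> P1 != P3 ->
  facet B T P1 -> facet B T P2 -> facet B T P3 ->
  (forall p, aff c1 p + aff c2 p + aff c3 p = 1) ->
  (forall p, p.1 = aff c1 p * P1.1 + aff c2 p * P2.1 + aff c3 p * P3.1) ->
  (forall p, p.2 = aff c1 p * P1.2 + aff c2 p * P2.2 + aff c3 p * P3.2) ->
  aff c2 P1 = 0 -> aff c2 P2 = 1 -> aff c2 P3 = 0 ->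
  Q \in B -> ~~ T Q -> 0 < aff c2 Q -> False.
Proof.
move=> B rX rY B1 B2 B3 T1 T2 T3 n12 n23 n13 [g1 z1 G1] [g2 z2 G2] [g3 z3 G3].
move=> csum cx cy c21 c22 c23 QB TQ cQ.
have inB p : (p \in B) = (p.1 \in X) && (p.2 \in Y).
  exact: mem_grid.
have TN p i : T i -> ~~ T p -> p != i by move=> Ti; apply: contraNneq => ->.
pose cand p := ~~ T p && (0 < aff c2 p).
have /seq_arg_min : has cand B by apply/hasP; exists Q; rewrite // /cand TQ.
move/(_ _ (aff c2)) => {Q QB TQ cQ} [Q [QB /andP[TQ cQ] Qmin]].
have g1Q : aff g1 Q < 0 by have := G1 _ QB (TN _ _ T1 TQ); rewrite (negbTE TQ).
have g2Q : aff g2 Q < 0 by have := G2 _ QB (TN _ _ T2 TQ); rewrite (negbTE TQ).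
have g3Q : aff g3 Q < 0 by have := G3 _ QB (TN _ _ T3 TQ); rewrite (negbTE TQ).
have g12 : 0 < aff g1 P2 by have := G1 _ B2; rewrite T2 eq_sym; apply.
have g13 : 0 < aff g1 P3 by have := G1 _ B3; rewrite T3 eq_sym; apply.
have g21 : 0 < aff g2 P1 by have := G2 _ B1; rewrite T1; apply.
have g23 : 0 < aff g2 P3 by have := G2 _ B3; rewrite T3 eq_sym; apply.
have g31 : 0 < aff g3 P1 by have := G3 _ B1; rewrite T1; apply.
have g32 : 0 < aff g3 P2 by have := G3 _ B2; rewrite T2; apply.
have affc g : aff g Q = aff c1 Q * aff g P1 + aff c2 Q * aff g P2 + aff c3 Q * aff g P3.
  transitivity (g.1.1 * Q.1 + g.1.2 * Q.2 + g.2 * (aff c1 Q + aff c2 Q + aff c3 Q)).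
    by rewrite csum mulr1.
  rewrite {1}(cx Q) {1}(cy Q) [aff g P1]/aff [aff g P2]/aff [aff g P3]/aff; ring.
(* In barycentric coordinates [g1] loses its [P1] term, so its negative value at [Q] forces a
   negative third coordinate; [g3] does the same for the first. Thus [Q] lies in the wedge opposite
   to the triangle at [P2], with [aff c2 Q] above [1]. *)
have c3n : aff c3 Q < 0 by have := affc g1; rewrite z1; nra.
have c1n : aff c1 Q < 0 by have := affc g3; rewrite z3; nra.
have c2E : aff c2 Q = 1 - aff c1 Q - aff c3 Q by have := csum Q; lra.
have Ex : Q.1 - P2.1 = aff c1 Q * (P1.1 - P2.1) + aff c3 Q * (P3.1 - P2.1).
  by rewrite {1}(cx Q) c2E; ring.
have Ey : Q.2 - P2.2 = aff c1 Q * (P1.2 - P2.2) + aff c3 Q * (P3.2 - P2.2).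
  by rewrite {1}(cy Q) c2E; ring.
move: (QB) (B1) (B2) (B3); rewrite !inB.
move=> /andP[Qx Qy] /andP[x1 y1] /andP[x2 y2] /andP[x3 y3].
have label_of_neg g P p : aff g P = 0 -> (forall p, p \in B -> p != P -> if T p then 0 < aff g p else aff g p < 0) ->
    p \in B -> aff g p < 0 -> ~~ T p.
  move=> z G pB gp; apply/negP => Tp; have [E|ne] := eqVneq p P.
    by move: gp; rewrite E z ltxx.
  by have := G _ pB ne; rewrite Tp; lra.
(* A grid point where a facet functional is negative has the label of [Q], so it competes with [Q]
   in the minimisation. *)
have noless g P p : aff g P = 0 ->
    (forall p, p \in B -> p != P -> if T p then 0 < aff g p else aff g p < 0) ->
    p \in B -> aff g p < 0 -> 0 < aff c2 p -> aff c2 p < aff c2 Q -> False.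
  move=> z G pB gp cp; rewrite ltNge; apply/negP/negPn; apply: Qmin => //.
  by apply/andP; split=> //; exact: label_of_neg z G _ _.
have cQ1 : 1 < aff c2 Q by have := csum Q; lra.
have affD g p q r : aff g (p.1 + q.1 - r.1, p.2 + q.2 - r.2) = aff g p + aff g q - aff g r.
  by rewrite /aff /=; ring.
(* The new point is the fourth vertex of a parallelogram: [g1] is negative there, and [aff c2] drops
   by exactly [1], staying positive because it exceeds [1] at [Q]. *)
have [b1|nb1] := boolP (between P1.1 P2.1 Q.1 && between P1.2 P2.2 Q.2).
  case/andP: b1 => bx by_.
  apply: (@noless g1 P1 (P1.1 + Q.1 - P2.1, P1.2 + Q.2 - P2.2)) => //.
  - by rewrite inB /= rX // rY.
  - by rewrite affD; clear -z1 z3 g12 g32 g1Q g3Q c21 c22 c23 cQ1; lra.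
  - by rewrite affD; clear -z1 z3 g12 g32 g1Q g3Q c21 c22 c23 cQ1; lra.
  - by rewrite affD; clear -z1 z3 g12 g32 g1Q g3Q c21 c22 c23 cQ1; lra.
have [b3|nb3] := boolP (between P3.1 P2.1 Q.1 && between P3.2 P2.2 Q.2).
  case/andP: b3 => bx by_.
  apply: (@noless g3 P3 (P3.1 + Q.1 - P2.1, P3.2 + Q.2 - P2.2)) => //.
  - by rewrite inB /= rX // rY.
  - by rewrite affD; clear -z1 z3 g12 g32 g1Q g3Q c21 c22 c23 cQ1; lra.
  - by rewrite affD; clear -z1 z3 g12 g32 g1Q g3Q c21 c22 c23 cQ1; lra.
  - by rewrite affD; clear -z1 z3 g12 g32 g1Q g3Q c21 c22 c23 cQ1; lra.
(* Otherwise [P1] and [P3] are separated from [P2] and [Q] in different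
   coordinates, and the corners of the box spanned by [P2] and [Q] do better. *)
have corner g : aff g P2 < aff g P1 -> aff g P2 < aff g P3 -> aff g Q < aff g P2 ->
    aff g (Q.1, P2.2) < aff g P2 /\ aff g Q < aff g (Q.1, P2.2).
  move=> h1 h3 h.
  have l1 : 0 < g.1.1 * (P1.1 - P2.1) + g.1.2 * (P1.2 - P2.2).
    by move: h1; rewrite /aff; clear; lra.
  have l3 : 0 < g.1.1 * (P3.1 - P2.1) + g.1.2 * (P3.2 - P2.2).
    by move: h3; rewrite /aff; clear; lra.
  have l : g.1.1 * (Q.1 - P2.1) + g.1.2 * (Q.2 - P2.2) < 0.
    by move: h; rewrite /aff; clear; lra.
  suff [kx ky] : g.1.1 * (Q.1 - P2.1) < 0 /\ g.1.2 * (Q.2 - P2.2) < 0.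
    by clear -kx ky; rewrite /aff /=; split; lra.
  have Ex' : Q.1 - P2.1 = aff c3 Q * (P3.1 - P2.1) + aff c1 Q * (P1.1 - P2.1).
    by rewrite Ex addrC.
  have Ey' : Q.2 - P2.2 = aff c3 Q * (P3.2 - P2.2) + aff c1 Q * (P1.2 - P2.2).
    by rewrite Ey addrC.
  (* If both conditions fail in the same coordinate, [P3] is at once opposite to [Q] and on its side
     of [P2]. Failures in different coordinates give the sign pattern of [linear_neg_quadrant], in
     either order of [P1] and [P3]. *)
  move: nb1 nb3; rewrite !negb_and => /orP[u1|u1] /orP[u3|u3].
  - have := not_between_sign _ _ _ _ _ _ c1n c3n Ex u1.
    have := not_between_sign _ _ _ _ _ _ c3n c1n Ex' u3.
    by clear; case=> [] [? ? ?]; case=> [] [? ? ?]; lra.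
  - have := not_between_sign _ _ _ _ _ _ c1n c3n Ex u1.
    have := not_between_sign _ _ _ _ _ _ c3n c1n Ey' u3.
    move=> hy hx.
    apply: (linear_neg_quadrant g.1.1 g.1.2 (P3.1 - P2.1) (P3.2 - P2.2) (P1.1 - P2.1) (P1.2 - P2.2)) => //.
      by case: hx => [] [? ? ?]; [left|right]; rewrite !subr_gt0 !subr_lt0.
    by case: hy => [] [? ? ?]; [left|right]; rewrite !subr_gt0 !subr_lt0.
  - have := not_between_sign _ _ _ _ _ _ c1n c3n Ey u1.
    have := not_between_sign _ _ _ _ _ _ c3n c1n Ex' u3.
    move=> hx hy.
    apply: (linear_neg_quadrant g.1.1 g.1.2 (P1.1 - P2.1) (P1.2 - P2.2) (P3.1 - P2.1) (P3.2 - P2.2)) => //.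
      by case: hx => [] [? ? ?]; [left|right]; rewrite !subr_gt0 !subr_lt0.
    by case: hy => [] [? ? ?]; [left|right]; rewrite !subr_gt0 !subr_lt0.
  - have := not_between_sign _ _ _ _ _ _ c1n c3n Ey u1.
    have := not_between_sign _ _ _ _ _ _ c3n c1n Ey' u3.
    by clear; case=> [] [? ? ?]; case=> [] [? ? ?]; lra.
have [g2R _] : aff g2 (Q.1, P2.2) < aff g2 P2 /\ aff g2 Q < aff g2 (Q.1, P2.2).
  by apply: corner; rewrite z2 //; exact: g2Q.
(* [corner] wants a functional that is smaller at [P2] than at [P1] and [P3], and smaller still at
   [Q]; [aff c2] behaves in the reverse way, hence the negation. *)
pose d : R * R * R := (- c2.1.1, - c2.1.2, - c2.2).
have dE p : aff d p = - aff c2 p by rewrite /aff /=; ring.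
have [d2R dQR] : aff d (Q.1, P2.2) < aff d P2 /\ aff d Q < aff d (Q.1, P2.2).
  by apply: corner; rewrite !dE ?c21 ?c22 ?c23 ltrN2 // ltr01.
apply: (@noless g2 P2 (Q.1, P2.2)) => //.
- by rewrite inB /= Qx.
- by rewrite -z2.
- by move: d2R; rewrite !dE ltrN2 c22; exact: lt_trans ltr01.
- by move: dQR; rewrite !dE ltrN2.
Qed.

(** Barycentric coordinates sum to [1], so some coordinate of [Q] is positive;
    [no_opposite_in_wedge] at the matching vertex excludes the other label. *)
Lemma facets_one_side (R : realType) (X Y : seq R) (T : pred (R * R))
    (P1 P2 P3 Q : R * R) :
  let B := [seq (x, y) | x <- X, y <- Y] in
  reflection_closed X -> reflection_closed Y ->
  P1 \in B -> P2 \in B -> P3 \in B -> T P1 -> T P2 -> T P3 ->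
  P1 != P2 -> P2 != P3 -> P1 != P3 ->
  facet B T P1 -> facet B T P2 -> facet B T P3 ->
  Q \in B -> T Q.
Proof.
move=> B rX rY B1 B2 B3 T1 T2 T3 n12 n23 n13 F1 F2 F3 QB.
apply/negPn/negP => TQ.
pose D := P1.1 * P2.2 - P2.1 * P1.2 + P2.1 * P3.2 - P3.1 * P2.2 + P3.1 * P1.2 - P1.1 * P3.2.
(* The matrix [aff g_i P_j] has zero diagonal and positive entries elsewhere, so its
   determinant is positive; it is also a multiple of [D]. *)
have D0 : D != 0.
  case: F1 F2 F3 => [g1 z1 G1] [g2 z2 G2] [g3 z3 G3].
  have g12 : 0 < aff g1 P2 by have := G1 _ B2; rewrite T2 eq_sym; apply.
  have g13 : 0 < aff g1 P3 by have := G1 _ B3; rewrite T3 eq_sym; apply.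
  have g21 : 0 < aff g2 P1 by have := G2 _ B1; rewrite T1; apply.
  have g23 : 0 < aff g2 P3 by have := G2 _ B3; rewrite T3 eq_sym; apply.
  have g31 : 0 < aff g3 P1 by have := G3 _ B1; rewrite T1; apply.
  have g32 : 0 < aff g3 P2 by have := G3 _ B2; rewrite T2; apply.
  have : 0 < aff g1 P2 * aff g2 P3 * aff g3 P1 + aff g1 P3 * aff g2 P1 * aff g3 P2.
    by rewrite addr_gt0 // !mulr_gt0.
  apply: contraTneq => DE; rewrite -leNgt.
  pose detg := g1.1.1 * (g2.1.2 * g3.2 - g2.2 * g3.1.2)
    - g1.1.2 * (g2.1.1 * g3.2 - g2.2 * g3.1.1)
    + g1.2 * (g2.1.1 * g3.1.2 - g2.1.2 * g3.1.1).
  suff -> : aff g1 P2 * aff g2 P3 * aff g3 P1 + aff g1 P3 * aff g2 P1 * aff g3 P2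
      = detg * D by rewrite DE mulr0.
  transitivity (aff g1 P1 * (aff g2 P2 * aff g3 P3 - aff g2 P3 * aff g3 P2)
    - aff g1 P2 * (aff g2 P1 * aff g3 P3 - aff g2 P3 * aff g3 P1)
    + aff g1 P3 * (aff g2 P1 * aff g3 P2 - aff g2 P2 * aff g3 P1)).
    by rewrite z1 z2 z3; ring.
  by rewrite /detg /D /aff; ring.
(* Cramer's rule: the functional vanishes on the line through [U] and [V], and dividing by [D],
   twice the signed area of the triangle, makes it [1] at the remaining vertex when the vertices are
   taken in cyclic order. *)
pose c (U V : R * R) : R * R * R :=
  ((U.2 - V.2) / D, (V.1 - U.1) / D, (U.1 * V.2 - V.1 * U.2) / D).
pose c1 := c P2 P3; pose c2 := c P3 P1; pose c3 := c P1 P2.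
have cs p : aff c1 p + aff c2 p + aff c3 p = 1.
  by rewrite /aff /= /D; field.
have cx p : p.1 = aff c1 p * P1.1 + aff c2 p * P2.1 + aff c3 p * P3.1.
  by rewrite /aff /= /D; field.
have cy p : p.2 = aff c1 p * P1.2 + aff c2 p * P2.2 + aff c3 p * P3.2.
  by rewrite /aff /= /D; field.
have c0l U V : aff (c U V) U = 0 by rewrite /aff /= /D; field.
have c0r U V : aff (c U V) V = 0 by rewrite /aff /= /D; field.
have c11 : aff c1 P1 = 1 by rewrite /aff /= /D; field.
have c22 : aff c2 P2 = 1 by rewrite /aff /= /D; field.
have c33 : aff c3 P3 = 1 by rewrite /aff /= /D; field.
have [p1|m1] := ltP 0 (aff c1 Q).
  apply: (@no_opposite_in_wedge R X Y T P2 P1 P3 c2 c1 c3 Q) => //; rewrite 1?eq_sym //.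
  - by move=> p; rewrite [aff c2 p + _]addrC.
  - by move=> p; rewrite [_ * P2.1 + _]addrC.
  - by move=> p; rewrite [_ * P2.2 + _]addrC.
  - exact: c0l.
  - exact: c0r.
have [p2|m2] := ltP 0 (aff c2 Q).
  apply: (@no_opposite_in_wedge R X Y T P1 P2 P3 c1 c2 c3 Q) => //; [exact: c0r | exact: c0l].
have p3 : 0 < aff c3 Q by have := cs Q; lra.
apply: (@no_opposite_in_wedge R X Y T P1 P3 P2 c1 c3 c2 Q) => //; rewrite 1?eq_sym //.
- by move=> p; rewrite addrAC.
- by move=> p; rewrite addrAC.
- by move=> p; rewrite addrAC.
- exact: c0l.
- exact: c0r.
Qed.

Lemma facetC {R : realType} (B : seq (R * R)) (T : pred (R * R)) (P : R * R) :
  facet B T P -> facet B [pred p | ~~ T p] P.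
Proof.
case=> g z G; exists (- g.1.1, - g.1.2, - g.2).
  by rewrite /aff /= !mulNr -!opprD [_ + _]z oppr0.
move=> p pB pP; have := G p pB pP; rewrite /aff /= !mulNr -!opprD oppr_gt0 oppr_lt0.
by case: (T p).
Qed.

Lemma three_distinct (T : eqType) (s : seq T) :
  uniq s -> (2 < size s)%N ->
  exists x y z, [/\ x \in s, y \in s & z \in s] /\ [/\ x != y, y != z & x != z].
Proof.
case: s => [|x [|y [|z s]]] //= /andP[]; rewrite !inE !negb_or => /and3P[xy xz _].
case/andP=> /andP[yz _] _ _; exists x, y, z.
by rewrite !inE !eqxx !orbT.
Qed.

Lemma facets_mixed (R : realType) (X Y : seq R) (T : pred (R * R)) (fs : seq (R * R))
    (Q : R * R) :
  let B := [seq (x, y) | x <- X, y <- Y] in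
  reflection_closed X -> reflection_closed Y -> uniq fs -> Q \in B -> ~~ T Q ->
  (forall P, P \in fs -> P \in B /\ facet B T P) ->
  (size [seq P <- fs | T P] <= 2)%N.
Proof.
move=> B rX rY ufs QB TQ fsB; rewrite leqNgt; apply/negP => h.
have [P1 [P2 [P3 []]]] := three_distinct _ _ (filter_uniq T ufs) h.
rewrite !mem_filter => -[/andP[T1 /fsB[B1 F1]] /andP[T2 /fsB[B2 F2]] /andP[T3 /fsB[B3 F3]]] [n12 n23 n13].
move/negP: TQ; apply.
exact: (@facets_one_side R X Y T P1 P2 P3 Q rX rY B1 B2 B3 T1 T2 T3 n12 n23 n13 F1 F2 F3 QB).
Qed.

(** On the row or column through [P] the functional is affine with its zero at [P], and strictness
    excludes slope zero. If [P] were interior to that row or column, the two ends would get opposite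
    signs, against the equal labels. *)
Lemma facet_extreme (R : realType) (X Y : seq R) (T : pred (R * R)) (P : R * R) (x0 x1 y0 y1 : R) :
  let B := [seq (x, y) | x <- X, y <- Y] in
  x0 \in X -> x1 \in X -> y0 \in Y -> y1 \in Y ->
  (forall x, x \in X -> x0 <= x <= x1) -> (forall y, y \in Y -> y0 <= y <= y1) ->
  {in B &, forall p q, T p = T q} -> P \in B -> facet B T P ->
  P \in [seq (x, y) | x <- [:: x0; x1], y <- [:: y0; y1]].
Proof.
move=> B x0X x1X y0Y y1Y hX hY TB PB [g z G].
move: (PB); rewrite !mem_grid => /andP[PX PY]; rewrite !inE.
have mid p q : p \in B -> q \in B -> p != P -> q != P ->
    aff g p * aff g q < 0 -> False.
  move=> pB qB pP qP; have := G p pB pP; have := G q qB qP; rewrite (TB p q pB qB).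
  case: (T q) => h1 h2; apply/negP; rewrite -leNgt ltW //; first by rewrite mulr_gt0.
  by rewrite nmulr_lgt0.
have affx x : aff g (x, P.2) = g.1.1 * (x - P.1).
  by rewrite -[LHS]subr0 -z /aff /=; ring.
have affy y : aff g (P.1, y) = g.1.2 * (y - P.2).
  by rewrite -[LHS]subr0 -z /aff /=; ring.
have neX x : x != P.1 -> (x, P.2) != P by apply: contraNneq => <-.
have neY y : y != P.2 -> (P.1, y) != P by apply: contraNneq => <-.
have nz p : p \in B -> p != P -> aff g p != 0.
  by move=> pB pP; have := G p pB pP; case: (T p) => [/lt0r_neq0|/ltr0_neq0].
apply/andP; split; apply: contraT; rewrite negb_or => /andP[].
- rewrite ![P.1 == _]eq_sym => n0 n1; exfalso.
  have B0 : (x0, P.2) \in B by rewrite mem_grid x0X.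
  have B1 : (x1, P.2) \in B by rewrite mem_grid x1X.
  apply: (mid _ _ B0 B1 (neX _ n0) (neX _ n1)).
  have := nz _ B0 (neX _ n0); rewrite !affx mulf_eq0 negb_or => /andP[g0 _].
  have /andP[l0 l1] := hX _ PX.
  have l0' : x0 - P.1 < 0 by rewrite subr_lt0 lt_neqAle n0.
  have l1' : 0 < x1 - P.1 by rewrite subr_gt0 lt_neqAle eq_sym n1.
  by rewrite mulrACA pmulr_rlt0 ?nmulr_rlt0 // -expr2 exprn_even_gt0.
- rewrite ![P.2 == _]eq_sym => n0 n1; exfalso.
  have B0 : (P.1, y0) \in B by rewrite mem_grid PX.
  have B1 : (P.1, y1) \in B by rewrite mem_grid PX.
  apply: (mid _ _ B0 B1 (neY _ n0) (neY _ n1)).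
  have := nz _ B0 (neY _ n0); rewrite !affy mulf_eq0 negb_or => /andP[g0 _].
  have /andP[l0 l1] := hY _ PY.
  have l0' : y0 - P.2 < 0 by rewrite subr_lt0 lt_neqAle n0.
  have l1' : 0 < y1 - P.2 by rewrite subr_gt0 lt_neqAle eq_sym n1.
  by rewrite mulrACA pmulr_rlt0 ?nmulr_rlt0 // -expr2 exprn_even_gt0.
Qed.

Lemma size_facets (R : realType) (X Y : seq R) (T : pred (R * R)) (x0 x1 y0 y1 : R) (fs : seq (R * R)) :
  let B := [seq (x, y) | x <- X, y <- Y] in
  reflection_closed X -> reflection_closed Y ->
  x0 \in X -> x1 \in X -> y0 \in Y -> y1 \in Y ->
  (forall x, x \in X -> x0 <= x <= x1) -> (forall y, y \in Y -> y0 <= y <= y1) ->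
  uniq fs -> (forall P, P \in fs -> P \in B /\ facet B T P) ->
  (size fs <= 4)%N.
Proof.
move=> B rX rY x0X x1X y0Y y1Y hX hY ufs fsB.
have corners : {in B &, forall p q, T p = T q} -> (size fs <= 4)%N.
  move=> TB; have -> : 4%N = size [seq (x, y) | x <- [:: x0; x1], y <- [:: y0; y1]] by [].
  apply: uniq_leq_size => // P /fsB[PB FP].
  exact: (@facet_extreme R X Y T P).
have [/allP allT|/allPn[Q QB TQ]] := boolP (all T B).
  by apply: corners => p q pB qB; rewrite !allT.
have [/hasP[Q' Q'B TQ']|/hasPn hT] := boolP (has T B); last first.
  by apply: corners => p q pB qB; rewrite (negbTE (hT _ pB)) (negbTE (hT _ qB)).
(* With both labels present, the facets are counted label by label, each time with a grid point of
   the opposite label as witness. *)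
rewrite -(count_predC T fs) -!size_filter (_ : 4 = 2 + 2)%N // leq_add //.
  exact: (@facets_mixed R X Y T fs Q).
apply: (@facets_mixed R X Y (predC T) fs Q') => //; first by rewrite /= negbK.
by move=> P /fsB[PB FP]; split=> //; exact: facetC.
Qed.

Lemma progression_reflection_closed (R : realType) (a d : R) (N : nat) :
  0 < d -> reflection_closed [seq a + k%:R * d | k <- iota 0 N.+1].
Proof.
move=> d0 x y z /mapP[i]; rewrite mem_iota add0n => /andP[_ iN] ->.
case/mapP=> j; rewrite mem_iota add0n => /andP[_ jN] ->.
case/mapP=> k; rewrite mem_iota add0n => /andP[_ kN] ->.
rewrite /between !lerD2l !ler_pM2r // !ler_nat => h.
(* Betweenness passes to the indices: [k] is at most the larger of [i] and [j], so the subtraction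
   is exact, and at least the smaller, so the new index is at most [N]. *)
have [l1 l2] : (k <= i + j /\ i + j - k < N.+1)%N by lia.
apply/mapP; exists (i + j - k)%N; first by rewrite mem_iota.
by rewrite natrB // natrD; ring.
Qed.

(** * Bounded cells *)

Definition lin {R : realType} (P z : R * R) : R := P.1 * z.1 + P.2 * z.2 - 1.

Definition slack {R : realType} (T : pred (R * R)) (P z : R * R) : R :=
  if T P then lin P z else - lin P z.

Definition cell {R : realType} (T : pred (R * R)) (S : seq (R * R)) : set (R * R) :=
  [set z | forall P, P \in S -> 0 <= slack T P z].

(** The parameter is any real number; values beyond [1] continue the segment as a ray from [x]. *)
Definition seg {R : realType} (x y : R * R) (t : R) : R * R :=
  (x.1 + t * (y.1 - x.1), x.2 + t * (y.2 - x.2)).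

Lemma lin_seg {R : realType} (P x y : R * R) (t : R) :
  lin P (seg x y t) = lin P x + t * (lin P y - lin P x).
Proof. by rewrite /lin /seg /=; ring. Qed.

Lemma slack_seg {R : realType} (T : pred (R * R)) (P x y : R * R) (t : R) :
  slack T P (seg x y t) = slack T P x + t * (slack T P y - slack T P x).
Proof. by rewrite /slack lin_seg; case: (T P) => //; ring. Qed.

Lemma slack_eq0 {R : realType} (T : pred (R * R)) (P z : R * R) :
  (slack T P z == 0) = (lin P z == 0).
Proof. by rewrite /slack; case: (T P); rewrite ?oppr_eq0. Qed.

Lemma lineP_lin {R : realType} (P z : R * R) : lineP P z <-> lin P z = 0.
Proof.
by rewrite /lineP /lin /=; split => [->|/eqP]; rewrite ?subrr // subr_eq0 => /eqP.
Qed.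

(** This symmetry is the duality by which points of the plane become functionals on the grid. *)
Lemma lin_sym {R : realType} (P z : R * R) : lin P z = lin z P.
Proof. by rewrite /lin; ring. Qed.

(** The line of [P] misses the origin, so two distinct points on it are linearly independent and
    determine its coefficients. *)
Lemma line_eq {R : realType} (P Q z1 z2 : R * R) :
  lin P z1 = 0 -> lin P z2 = 0 -> lin Q z1 = 0 -> lin Q z2 = 0 -> z1 != z2 -> P = Q.
Proof.
case: P Q z1 z2 => [p1 p2] [q1 q2] [x1 y1] [x2 y2]; rewrite /lin /= => h1 h2 h3 h4 ne.
have D0 : x1 * y2 - x2 * y1 != 0.
  apply: contra ne => /eqP D0; rewrite xpair_eqE -!(subr_eq0 _ x2) -!(subr_eq0 _ y2).
  have -> : x1 - x2 = p2 * (x1 * y2 - x2 * y1) - x1 * (p1 * x2 + p2 * y2 - 1)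
      + x2 * (p1 * x1 + p2 * y1 - 1) by ring.
  have -> : y1 - y2 = - p1 * (x1 * y2 - x2 * y1) - y1 * (p1 * x2 + p2 * y2 - 1)
      + y2 * (p1 * x1 + p2 * y1 - 1) by ring.
  by rewrite h1 h2 D0 !mulr0 !subr0 !addr0 eqxx.
have e1 : p1 = q1.
  apply/eqP; rewrite -subr_eq0 -(inj_eq (mulIf D0)) mul0r.
  have -> : (p1 - q1) * (x1 * y2 - x2 * y1) =
    y2 * ((p1 * x1 + p2 * y1 - 1) - (q1 * x1 + q2 * y1 - 1)) -
    y1 * ((p1 * x2 + p2 * y2 - 1) - (q1 * x2 + q2 * y2 - 1)) by ring.
  by rewrite h1 h2 h3 h4 !subr0 !mulr0 subr0.
have e2 : p2 = q2.
  apply/eqP; rewrite -subr_eq0 -(inj_eq (mulIf D0)) mul0r.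
  have -> : (p2 - q2) * (x1 * y2 - x2 * y1) =
    x1 * ((p1 * x2 + p2 * y2 - 1) - (q1 * x2 + q2 * y2 - 1)) -
    x2 * ((p1 * x1 + p2 * y1 - 1) - (q1 * x1 + q2 * y1 - 1)) by ring.
  by rewrite h1 h2 h3 h4 !subr0 !mulr0 subr0.
by rewrite e1 e2.
Qed.

Lemma ray_unbounded {R : realFieldType} (u d r : R) :
  d != 0 -> (forall t, 0 <= t -> `|u + t * d| <= r) -> False.
Proof.
move=> d0 h; have r0 : 0 <= r by apply: le_trans (h 0 (lexx _)).
have nd : 0 < `|d| by rewrite normr_gt0.
pose t := (r + `|u| + 1) / `|d|.
have t0 : 0 <= t by rewrite divr_ge0 // !addr_ge0.
have := h t t0; apply/negP; rewrite -ltNge.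
have : `|t * d| <= `|u + t * d| + `|u|.
  by rewrite -{1}[t * d](addKr u) addrC (le_trans (ler_normB _ _)).
by rewrite normrM (ger0_norm t0) /t divfK ?gt_eqF //; lra.
Qed.

(** Some slack decreases from [z] towards [y], since otherwise the whole ray would stay in the
    bounded cell. Each decreasing slack vanishes at the parameter given by the quotient below, and
    the smallest quotient is the moment of exit. *)
Lemma cell_exit {R : realType} (T : pred (R * R)) (S : seq (R * R)) (z y : R * R) :
  bounded_plane (cell T S) -> cell T S z -> y != z ->
  exists t P, [/\ 0 <= t, P \in S, cell T S (seg z y t), slack T P (seg z y t) = 0 &
                  slack T P y < slack T P z].
Proof.
move=> [r hr] zS yz.
have /(@seq_arg_min _ _ (fun P => slack T P z / (slack T P z - slack T P y))) :
    has (fun P => slack T P y < slack T P z) S.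
  apply: contraT => /hasPn hS; exfalso.
  have ray t : 0 <= t -> cell T S (seg z y t).
    move=> t0 P PS; rewrite slack_seg addr_ge0 ?zS // mulr_ge0 // subr_ge0.
    by have := hS P PS; rewrite -leNgt.
  have [e1|n1] := eqVneq (y.1 - z.1) 0; last first.
    by apply: (ray_unbounded z.1 _ r n1) => t /ray/hr[].
  have [e2|n2] := eqVneq (y.2 - z.2) 0; last first.
    by apply: (ray_unbounded z.2 _ r n2) => t /ray/hr[].
  move/eqP: yz; apply; move: e1 e2; clear; case: y z => [? ?] [? ?] /= /eqP + /eqP.
  by rewrite !subr_eq0 => /eqP-> /eqP->.
case=> P [PS Py Pmin].
have dP : 0 < slack T P z - slack T P y by rewrite subr_gt0.
exists (slack T P z / (slack T P z - slack T P y)), P; split=> //.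
- by rewrite divr_ge0 ?zS // ltW.
- move=> Q QS; rewrite slack_seg; set t := _ / _.
  have t0 : 0 <= t by rewrite divr_ge0 ?zS // ltW.
  have [lQ|gQ] := ltP (slack T Q y) (slack T Q z); last first.
    by rewrite addr_ge0 ?zS // mulr_ge0 // subr_ge0.
  have dQ : 0 < slack T Q z - slack T Q y by rewrite subr_gt0.
  by have := Pmin Q QS lQ; rewrite -/t ler_pdivlMr //; lra.
- by rewrite slack_seg -[slack T P y - _]opprB mulrN divfK ?gt_eqF // subrr.
Qed.

Lemma essential_subfamily {R : realType} (T : pred (R * R)) (S : seq (R * R)) :
  exists G, [/\ uniq G, {subset G <= S}, cell T G = cell T S &
    forall P, P \in G -> exists2 y, slack T P y < 0 &
      forall Q, Q \in G -> Q != P -> 0 <= slack T Q y].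
Proof.
suff H n : forall S : seq (R * R), uniq S -> (size S <= n)%N ->
  exists G, [/\ uniq G, {subset G <= S}, cell T G = cell T S &
    forall P, P \in G -> exists2 y, slack T P y < 0 &
      forall Q, Q \in G -> Q != P -> 0 <= slack T Q y].
  have [G [uG GS cG hG]] := H _ _ (undup_uniq S) (leqnn _).
  exists G; split=> //; first by move=> P /GS; rewrite mem_undup.
  by rewrite cG; apply/seteqP; split=> z h P PS; apply: h; move: PS; rewrite mem_undup.
elim: n => [|n IH] {}S uS sS.
  by exists [::]; move: sS; rewrite leqn0 size_eq0 => /eqP->; split.
have [all_ess|] := pselect (forall P, P \in S -> exists2 y, slack T P y < 0 &
      forall Q, Q \in S -> Q != P -> 0 <= slack T Q y); first by exists S; split.
move=> /existsNP[P /not_implyP[PS nP]].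
have [|G [uG GS cG hG]] := IH _ (rem_uniq P uS).
  by rewrite size_rem // -subn1 leq_subLR add1n.
exists G; split=> //; first by move=> Q /GS /mem_rem.
rewrite cG; apply/seteqP; split=> z h Q QS; last by apply: h; exact: mem_rem QS.
have h' Q' : Q' \in S -> Q' != P -> 0 <= slack T Q' z.
  by move=> Q'S nQ; apply: h; rewrite mem_rem_uniq // inE nQ.
have [->|] := eqVneq Q P; last exact: h'.
by rewrite leNgt; apply/negP => lt0; apply: nP; exists z.
Qed.

(** [(- P.2, P.1)] is the direction of the line of [P]; it is nonzero because [lin (0, 0) z] is
    [-1]. *)
Lemma lin_eq0_neq {R : realType} (P z : R * R) : lin P z = 0 ->
  (z.1 - P.2, z.2 + P.1) != z.
Proof.
move=> h; apply/negP => /eqP; case: z P h => [z1 z2] [p1 p2]; rewrite /lin /= => h [e1 e2].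
have p20 : p2 = 0 by lra.
have p10 : p1 = 0 by lra.
by move: h; rewrite p10 p20 !mul0r; lra.
Qed.

Lemma lin_along {R : realType} (P z : R * R) :
  lin P (z.1 - P.2, z.2 + P.1) = lin P z.
Proof. by rewrite /lin /=; ring. Qed.

(** The segment from the interior point [x] to [y] crosses the line of [P] at a point [m] before
    reaching [y], so every other constraint is still strict at [m]. *)
Lemma essential_side_line {R : realType} (T : pred (R * R)) (G : seq (R * R)) (x y P : R * R) :
  bounded_plane (cell T G) -> (forall Q, Q \in G -> 0 < slack T Q x) -> P \in G ->
  slack T P y < 0 -> (forall Q, Q \in G -> Q != P -> 0 <= slack T Q y) ->
  side_line (cell T G) P.
Proof.
move=> bG xG PG yP yG; have xP := xG P PG.
have d0 : 0 < slack T P x - slack T P y by lra.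
pose t := slack T P x / (slack T P x - slack T P y).
have td : t * (slack T P x - slack T P y) = slack T P x by rewrite divfK ?gt_eqF.
have t0 : 0 <= t by rewrite divr_ge0 // ltW.
have t1 : t < 1 by rewrite ltr_pdivrMr // mul1r; lra.
pose m := seg x y t.
have mP : slack T P m = 0 by rewrite slack_seg; lra.
have mQ Q : Q \in G -> Q != P -> 0 < slack T Q m.
  move=> QG QP; have hx := xG Q QG; have hy := yG Q QG QP.
  rewrite slack_seg (_ : _ + _ = (1 - t) * slack T Q x + t * slack T Q y); last by ring.
  by apply: ltr_pwDl; [apply: mulr_gt0; rewrite ?subr_gt0|apply: mulr_ge0].
have mG : cell T G m.
  by move=> Q QG; have [->|/(mQ Q QG)/ltW] := eqVneq Q P; rewrite ?mP.
have lP : lin P m = 0 by apply/eqP; rewrite -(slack_eq0 T) mP.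
(* Walking along the line from [m] keeps the slack of [P] constant, so the walk is stopped by
   another constraint, which is strict at [m]; the endpoint is therefore a second point of the
   side. *)
have [s [Q [s0 QG mG' Qs Qlt]]] := cell_exit _ _ _ _ bG mG (lin_eq0_neq _ _ lP).
have QP : Q != P.
  apply: contraTneq Qlt => ->; rewrite /slack lin_along; by case: (T P); rewrite ltxx.
exists m, (seg m (m.1 - P.2, m.2 + P.1) s); split=> //.
- exact/lineP_lin.
- by apply/lineP_lin; rewrite lin_seg lin_along lP subrr mulr0 addr0.
- by move=> E; have := mQ Q QG QP; rewrite {1}E Qs ltxx.
Qed.

(** At the midpoint of two points of the side, every other slack is an average of two nonnegative
    numbers, which by [line_eq] do not both vanish. *)
Lemma side_line_facet {R : realType} (T : pred (R * R)) (B : seq (R * R)) (P : R * R) :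
  T (0, 0) = false ->
  P \in B -> P != (0, 0) -> side_line (cell T [seq Q <- B | Q != (0, 0)]) P ->
  facet B T P.
Proof.
move=> T0 PB P0 [z1 [z2 [c1 c2 /lineP_lin l1 /lineP_lin l2 /eqP z12]]].
exists (seg z1 z2 2^-1, -1).
  by rewrite -[LHS]/(lin (seg z1 z2 2^-1) P) lin_sym lin_seg l1 l2 subrr mulr0 addr0.
move=> Q QB QP; rewrite -[aff _ Q]/(lin (seg z1 z2 2^-1) Q) lin_sym.
(* The origin defines no line, but it may belong to the full grid [B]; the functional is [-1] there,
   in agreement with its label. *)
have [->|Q0] := eqVneq Q (0, 0).
  by rewrite T0 /lin /= !mul0r addr0 add0r oppr_lt0 ltr01.
have QS : Q \in [seq Q <- B | Q != (0, 0)] by rewrite mem_filter Q0.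
have Qz : (lin Q z1 != 0) || (lin Q z2 != 0).
  rewrite -negb_and; apply: contra QP => /andP[/eqP e1 /eqP e2].
  by apply/eqP/(line_eq Q P z1 z2).
have := c1 Q QS; have := c2 Q QS; rewrite lin_seg /slack; case: (T Q) => h2 h1.
  case/orP: Qz => n; [have : 0 < lin Q z1|have : 0 < lin Q z2];
    rewrite ?lt0r ?n //; lra.
case/orP: Qz => n; [have : 0 < - lin Q z1|have : 0 < - lin Q z2];
  rewrite ?lt0r ?oppr_eq0 ?n //; lra.
Qed.

(** * Convex hulls and vertices of a cell *)

Lemma conv_hull_mem {R : realType} (vs : seq (R * R)) (v : R * R) :
  v \in vs -> conv_hull vs v.
Proof.
move=> vvs; have iv : (index v vs < size vs)%N by rewrite index_mem.
exists (fun i => (i == Ordinal iv)%:R); split.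
- by move=> i; rewrite ler0n.
- by rewrite (bigD1 (Ordinal iv)) //= eqxx big1 ?addr0 // => i /negbTE ->.
- rewrite (bigD1 (Ordinal iv)) //= eqxx mul1r nth_index // big1 ?addr0 //.
  by move=> i /negbTE ->; rewrite mul0r.
- rewrite (bigD1 (Ordinal iv)) //= eqxx mul1r nth_index // big1 ?addr0 //.
  by move=> i /negbTE ->; rewrite mul0r.
Qed.

Lemma conv_hull_seg {R : realType} (vs : seq (R * R)) (x y : R * R) (t : R) :
  conv_hull vs x -> conv_hull vs y -> 0 <= t <= 1 -> conv_hull vs (seg x y t).
Proof.
move=> [w [w0 w1 wx wy]] [u [u0 u1 ux uy]] /andP[t0 t1].
exists (fun i => (1 - t) * w i + t * u i); split.
- by move=> i; rewrite addr_ge0 // mulr_ge0 // subr_ge0.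
- by rewrite big_split /= -!mulr_sumr w1 u1; ring.
- rewrite (eq_bigr (fun i => (1 - t) * (w i * (nth (0, 0) vs i).1)
    + t * (u i * (nth (0, 0) vs i).1))); last by move=> i _; ring.
  by rewrite big_split /= -!mulr_sumr -wx -ux; ring.
- rewrite (eq_bigr (fun i => (1 - t) * (w i * (nth (0, 0) vs i).2)
    + t * (u i * (nth (0, 0) vs i).2))); last by move=> i _; ring.
  by rewrite big_split /= -!mulr_sumr -wy -uy; ring.
Qed.

(** The two points lie on opposite rays from [z], at multiples [s] and [t] of the same vector, so
    [z] is their combination with parameter [s / (s + t)]; if [s + t] is zero, both points are
    [z]. *)
Lemma conv_hull_between {R : realType} (vs : seq (R * R)) (z y y' : R * R) (s t : R) :
  0 <= s -> 0 <= t -> y.1 - z.1 = z.1 - y'.1 -> y.2 - z.2 = z.2 - y'.2 ->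
  conv_hull vs (seg z y s) -> conv_hull vs (seg z y' t) -> conv_hull vs z.
Proof.
move=> s0 t0 e1 e2 hs ht; have [st|st] := eqVneq (s + t) 0.
  have sE : s = 0 by lra.
  by move: hs; rewrite sE /seg !mul0r !addr0 -surjective_pairing.
have st0 : 0 < s + t by rewrite lt0r st addr_ge0.
suff -> : z = seg (seg z y s) (seg z y' t) (s / (s + t)).
  apply: conv_hull_seg => //; apply/andP; split; first by rewrite divr_ge0 // ltW.
  by rewrite ler_pdivrMr // mul1r lerDl.
rewrite [LHS]surjective_pairing /seg /=; congr pair.
  by rewrite e1; field.
by rewrite e2; field.
Qed.

Lemma conv_hull_cell {R : realType} (T : pred (R * R)) (S vs : seq (R * R)) :
  (forall v, v \in vs -> cell T S v) -> conv_hull vs `<=` cell T S.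
Proof.
move=> vsS z [w [w0 w1 wx wy]] P PS.
suff -> : slack T P z = \sum_(i < size vs) w i * slack T P (nth (0, 0) vs i).
  by apply: sumr_ge0 => i _; rewrite mulr_ge0 // vsS // mem_nth.
have linE : lin P z = \sum_(i < size vs) w i * lin P (nth (0, 0) vs i).
  rewrite {1}/lin wx wy !mulr_sumr -{1}w1 -big_split -sumrB /=.
  by apply: eq_bigr => i _; rewrite /lin; ring.
rewrite /slack; case: (T P); first exact: linE.
by rewrite linE -sumrN; apply: eq_bigr => i _; rewrite mulrN.
Qed.

(** Incidence is used in place of extremality: it makes the vertices finite in number and allows
    counting them against the lines. *)
Definition vertex {R : realType} (T : pred (R * R)) (G : seq (R * R)) (v : R * R) : Prop :=
  cell T G v /\ exists P Q, [/\ P \in G, Q \in G, P != Q, lin P v = 0 & lin Q v = 0].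

(** Cramer's rule. For [D = 0] division returns the default [0]; distinct lines with a common point
    never reach this case. *)
Definition line_meet {R : realType} (P Q : R * R) : R * R :=
  let D := P.1 * Q.2 - P.2 * Q.1 in ((Q.2 - P.2) / D, (P.1 - Q.1) / D).

Lemma line_meetP {R : realType} (P Q v : R * R) :
  P != Q -> lin P v = 0 -> lin Q v = 0 -> v = line_meet P Q.
Proof.
move=> PQ hP hQ; have [D0|D0] := eqVneq (P.1 * Q.2 - P.2 * Q.1) 0.
  exfalso; move/eqP: PQ; apply; move: hP hQ D0; rewrite /lin.
  case: P Q v => [p1 p2] [q1 q2] [x y] /= hP hQ D0; congr pair.
    have -> : p1 = q1 - (p1 * x + p2 * y - 1) * (- q1) + (- (p1 * (q1 * x + q2 * y - 1)))
       + y * (p1 * q2 - p2 * q1) by ring.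
    by rewrite hP hQ D0 !mulr0 mul0r !oppr0 !addr0.
  have -> : p2 = q2 - (p1 * x + p2 * y - 1) * (- q2) + (- (p2 * (q1 * x + q2 * y - 1)))
     - x * (p1 * q2 - p2 * q1) by ring.
  by rewrite hP hQ D0 !mulr0 mul0r !oppr0 !addr0.
rewrite [v]surjective_pairing /line_meet; congr pair.
  apply: (mulIf D0); rewrite divfK //; apply/eqP; rewrite -subr_eq0.
  have -> : v.1 * (P.1 * Q.2 - P.2 * Q.1) - (Q.2 - P.2) =
    Q.2 * lin P v - P.2 * lin Q v by rewrite /lin; ring.
  by rewrite hP hQ !mulr0 subrr.
apply: (mulIf D0); rewrite divfK //; apply/eqP; rewrite -subr_eq0.
have -> : v.2 * (P.1 * Q.2 - P.2 * Q.1) - (P.1 - Q.1) =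
  P.1 * lin Q v - Q.1 * lin P v by rewrite /lin; ring.
by rewrite hP hQ !mulr0 subrr.
Qed.

Lemma vertex_seq {R : realType} (T : pred (R * R)) (G : seq (R * R)) :
  exists2 V : seq (R * R), uniq V & forall v, v \in V <-> vertex T G v.
Proof.
exists (undup [seq v <- [seq line_meet P Q | P <- G, Q <- G] | `[< vertex T G v >]]).
  exact: undup_uniq.
move=> v; rewrite mem_undup mem_filter; split => [/andP[/asboolP]//|Vv].
apply/andP; split; first exact/asboolP.
case: Vv => _ [P [Q [PG QG PQ lP lQ]]].
by apply/allpairsP; exists (P, Q); split=> //=; exact: line_meetP.
Qed.

(** From a point on one of the lines, walking along that line in both directions ends at vertices.
    From any other point of the cell, walking horizontally both ways ends on such lines. In each
    case the starting point lies between the two ends. *)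
Lemma cell_sub_hull {R : realType} (T : pred (R * R)) (G V : seq (R * R)) :
  bounded_plane (cell T G) -> (forall v, vertex T G v -> v \in V) ->
  cell T G `<=` conv_hull V.
Proof.
move=> bG hV.
have face z P : cell T G z -> P \in G -> lin P z = 0 -> conv_hull V z.
  move=> zG PG lP; have n1 := lin_eq0_neq P z lP.
  have n2 : (z.1 + P.2, z.2 - P.1) != z.
    apply: contra n1 => /eqP E; rewrite -{3}E xpair_eqE; move: E.
    by case: z {zG lP} => [z1 z2] [] /=; lra.
  have l2 : lin P (z.1 + P.2, z.2 - P.1) = lin P z by rewrite /lin /=; ring.
  have hull y : y != z -> lin P y = lin P z -> exists2 t, 0 <= t & conv_hull V (seg z y t).
    move=> yz ly; have [t [Q [t0 QG tG Qt ltQ]]] := cell_exit _ _ _ _ bG zG yz.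
    exists t => //; apply/conv_hull_mem/hV; split=> //; exists P, Q; split=> //.
    - by apply: contraTneq ltQ => <-; rewrite /slack ly; case: (T P); rewrite ltxx.
    - by rewrite lin_seg ly lP subrr mulr0 addr0.
    - by apply/eqP; rewrite -(slack_eq0 T) Qt.
  have [s s0 hs1] := hull _ n1 (lin_along P z).
  have [t t0 hs2] := hull _ n2 l2.
  by apply: conv_hull_between s0 t0 _ _ hs1 hs2 => /=; ring.
move=> z zG.
have hull y : y != z -> exists2 t, 0 <= t & conv_hull V (seg z y t).
  move=> yz; have [t [Q [t0 QG tG Qt ltQ]]] := cell_exit _ _ _ _ bG zG yz.
  exists t => //; apply: (face _ Q) => //.
  by apply/eqP; rewrite -(slack_eq0 T) Qt.
have n1 : (z.1 + 1, z.2) != z.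
  by apply/negP => /eqP; case: z {zG hull} => [z1 z2] [] /=; lra.
have n2 : (z.1 - 1, z.2) != z.
  by apply/negP => /eqP; case: z {zG hull n1} => [z1 z2] [] /=; lra.
have [s s0 hs1] := hull _ n1.
have [t t0 hs2] := hull _ n2.
by apply: conv_hull_between s0 t0 _ _ hs1 hs2 => /=; ring.
Qed.

(** A second line [Q] passes through the vertex. Its slack is nonnegative at both ends and zero
    strictly between them, hence zero at both, and [line_eq] identifies [Q] with [P]. *)
Lemma no_middle_vertex {R : realType} (T : pred (R * R)) (G : seq (R * R)) (P v1 v2 v3 : R * R) (t : R) :
  P \in G -> lin P v1 = 0 -> lin P v3 = 0 -> v1 != v3 ->
  cell T G v1 -> cell T G v3 -> 0 < t < 1 -> vertex T G (seg v1 v3 t) -> False.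
Proof.
move=> PG l1 l3 n13 c1 c3 /andP[t0 t1] [_ [Q1 [Q2 [Q1G Q2G Q12 lQ1 lQ2]]]].
have [Q [QG QP lQ]] : exists Q, [/\ Q \in G, Q != P & lin Q (seg v1 v3 t) = 0].
  by have [E|n] := eqVneq Q1 P; [exists Q2; rewrite eq_sym -E|exists Q1].
have hQ : slack T Q (seg v1 v3 t) = 0 by apply/eqP; rewrite slack_eq0 lQ.
move: hQ; rewrite slack_seg; have := c1 Q QG; have := c3 Q QG => h3 h1 hQ.
have z1 : slack T Q v1 = 0 by nra.
have z3 : slack T Q v3 = 0 by nra.
move/eqP: QP; apply; apply: (line_eq Q P v1 v3) => //; apply/eqP; rewrite -(slack_eq0 T).
  by rewrite z1.
by rewrite z3.
Qed.

Lemma vertices_on_line {R : realType} (T : pred (R * R)) (G V : seq (R * R)) (P : R * R) :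
  uniq V -> (forall v, v \in V -> vertex T G v) -> P \in G ->
  (count (fun v => lin P v == 0%R) V <= 2)%N.
Proof.
move=> uV hV PG; rewrite -size_filter leqNgt; apply/negP => h3.
have [v1 [v2 [v3 []]]] := three_distinct _ _ (filter_uniq _ uV) h3.
rewrite !mem_filter => -[/andP[/eqP l1 /hV V1] /andP[/eqP l2 /hV V2] /andP[/eqP l3 /hV V3]] [].
(* [tau] is a coordinate along the line, up to scale, and [coord] recovers the point from it.
   Sorting three vertices by [tau] exposes one strictly between the other two. *)
pose tau (v : R * R) := P.1 * v.2 - P.2 * v.1.
pose N := P.1 ^+ 2 + P.2 ^+ 2.
have N0 : 0 < N.
  rewrite lt0r addr_ge0 ?sqr_ge0 // andbT paddr_eq0 ?sqr_ge0 // !sqrf_eq0.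
  apply/negP => /andP[/eqP e1 /eqP e2]; move: l1; rewrite /lin e1 e2 !mul0r; lra.
have coord v : lin P v = 0 -> v = ((P.1 - P.2 * tau v) / N, (P.2 + P.1 * tau v) / N).
  move=> l; rewrite [LHS]surjective_pairing; congr pair; apply: (mulIf (lt0r_neq0 N0)).
    rewrite divfK ?gt_eqF // -[LHS]subr0 -[0](mulr0 P.1) -l /lin /tau /N; ring.
  rewrite divfK ?gt_eqF // -[LHS]subr0 -[0](mulr0 P.2) -l /lin /tau /N; ring.
have mid u v w : lin P u = 0 -> lin P v = 0 -> lin P w = 0 -> vertex T G u -> vertex T G v ->
    vertex T G w -> tau u < tau v -> tau v < tau w -> False.
  move=> lu lv lw Vu Vv Vw uv vw.
  have d0 : 0 < tau w - tau u by rewrite subr_gt0 (lt_trans uv).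
  pose t := (tau v - tau u) / (tau w - tau u).
  apply: (@no_middle_vertex R T G P u v w t) => //.
  - by apply/eqP => E; move: d0; rewrite E subrr ltxx.
  - by case: Vu.
  - by case: Vw.
  - apply/andP; split; first by rewrite divr_gt0 // subr_gt0.
    by rewrite ltr_pdivrMr // mul1r ltrD2r.
  - suff -> : seg u w t = v by [].
    rewrite [RHS]coord // /seg (coord u lu) (coord w lw) /=.
    have -> : tau v = tau u + t * (tau w - tau u) by rewrite /t divfK ?gt_eqF //; ring.
    by congr pair; field; exact: lt0r_neq0.
have tau_inj u v : lin P u = 0 -> lin P v = 0 -> u != v -> tau u != tau v.
  by move=> lu lv; apply: contraNneq => E; rewrite (coord u lu) (coord v lv) E.
move=> /(tau_inj _ _ l1 l2) + /(tau_inj _ _ l2 l3) + /(tau_inj _ _ l1 l3).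
case: (ltrgtP (tau v1) (tau v2)) => // a _; case: (ltrgtP (tau v2) (tau v3)) => // b _;
case: (ltrgtP (tau v1) (tau v3)) => // c _.
- exact: (mid v1 v2 v3).
- by have := lt_trans a b; rewrite ltNge ltW.
- exact: (mid v1 v3 v2).
- exact: (mid v3 v1 v2).
- exact: (mid v2 v1 v3).
- exact: (mid v2 v3 v1).
- by have := lt_trans b a; rewrite ltNge ltW.
- exact: (mid v3 v2 v1).
Qed.

(** Incidences are counted twice: each vertex is on at least two lines, and each line carries at
    most two vertices. *)
Lemma size_vertices {R : realType} (T : pred (R * R)) (G V : seq (R * R)) :
  uniq G -> uniq V -> (forall v, v \in V -> vertex T G v) -> (size V <= size G)%N.
Proof.
have sum2 (s : seq (R * R)) : (size s * 2 = \sum_(v <- s) 2)%N.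
  by rewrite big_const_seq count_predT iter_addn_0 mulnC.
move=> uG uV hV; rewrite -(leq_pmul2r (isT : 0 < 2)%N).
apply: (@leq_trans (\sum_(v <- V) count (fun P => lin P v == 0%R) G)%N).
  rewrite sum2 big_seq [leqRHS]big_seq.
  apply: leq_sum => v /hV[_ [P [Q [PG QG PQ lP lQ]]]].
  rewrite -size_filter -[2%N]/(size [:: P; Q]); apply: uniq_leq_size.
    by rewrite /= inE PQ.
  by move=> Q'; rewrite !inE mem_filter => /orP[] /eqP->; rewrite ?lP ?lQ eqxx.
rewrite (eq_bigr (fun v => \sum_(P <- G) (lin P v == 0%R : nat))%N); last first.
  by move=> v _; rewrite -sum1_count big_mkcond /=; apply: eq_bigr => P _; case: eqP.
rewrite exchange_big /= sum2 big_seq [leqRHS]big_seq.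
apply: leq_sum => P PG; apply: leq_trans (vertices_on_line _ _ _ _ uV hV PG).
by rewrite -sum1_count [leqRHS]big_mkcond /=; apply: leq_sum => v _; case: eqP.
Qed.

(** * Regions are cells *)

Lemma seg_continuous {R : realType} (x y : R * R) : continuous (seg x y).
Proof.
move=> t; have coord (u d : R) : u + s * d @[s --> t] --> u + t * d.
  by apply: cvgD; [exact: cvg_cst|apply: cvgM; [exact: cvg_id|exact: cvg_cst]].
exact: (cvg_pair (coord x.1 (y.1 - x.1)) (coord x.2 (y.2 - x.2))).
Qed.

Lemma lin_continuous {R : realType} (P : R * R) : continuous (lin P).
Proof.
move=> z; apply: cvgB; last exact: cvg_cst.
by apply: cvgD; (apply: cvgM; first exact: cvg_cst); [exact: cvg_fst|exact: cvg_snd].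
Qed.

(** The image of the component under [lin P] is an interval that avoids [0]. *)
Lemma component_same_sign {R : realType} (A : set (R * R)) (P x y : R * R) :
  A `<=` ~` lineP P -> connected_component A x y -> A x ->
  (0 < lin P x) = (0 < lin P y).
Proof.
move=> AP cy Ax.
have cx := connected_component_refl Ax.
have ci : is_interval (lin P @` connected_component A x).
  apply/connected_intervalP/connected_continuous_connected.
    exact: component_connected.
  exact/continuous_subspaceT/lin_continuous.
have nz z : connected_component A x z -> lin P z != 0.
  move=> /connected_component_sub/AP Pz; apply/negP => /eqP/lineP_lin; exact: Pz.
have n0 : ~ (lin P @` connected_component A x) 0.
  by case=> z /nz + E; rewrite E eqxx.
have mid u v : connected_component A x u -> connected_component A x v ->
    lin P u < 0 -> 0 < lin P v -> False.
  move=> cu cv u0 v0; apply: n0; apply: (ci (lin P u) (lin P v)).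
  - by exists u.
  - by exists v.
  - by rewrite !ltW.
apply/idP/idP => h; rewrite ltNge le_eqVlt negb_or nz //=; apply/negP => h'.
  exact: mid h' h.
exact: mid h' h.
Qed.

(** The component keeps the signs of [x] and the cell is closed, which gives one inclusion.
    Conversely, points with all slacks positive are joined to [x] by a segment, and any point of the
    cell is approached by such points along its segment to [x]. *)
Lemma closure_component {R : realType} (S : seq (R * R)) (A : set (R * R)) (x : R * R) :
  A = ~` (\bigcup_(P in [set` S]) lineP P) -> A x ->
  closure (connected_component A x) = cell [pred P | 0 < lin P x] S.
Proof.
move=> AE Ax; set T := [pred P | _].
have xS P : P \in S -> 0 < slack T P x.
  move=> PS; rewrite /slack /T /=; case: (ltP 0 (lin P x)) => // le0; rewrite oppr_gt0 lt_neqAle le0 andbT.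
  by apply/negP => /eqP/lineP_lin lx; move: Ax; rewrite AE; apply; exists P.
have sub P : P \in S -> A `<=` ~` lineP P.
  by move=> PS z; rewrite AE => Az Pz; apply: Az; exists P.
have open_sub z : (forall P, P \in S -> 0 < slack T P z) -> connected_component A x z.
  move=> zS; apply: (@connected_component_max _ A (seg x z @` `[0, 1])).
  - exists 0; first by rewrite /= in_itv /= lexx ler01.
    by rewrite /seg !mul0r !addr0 -surjective_pairing.
  - move=> _ [t /= ti <-]; move: ti; rewrite in_itv /= => /andP[t0 t1]; rewrite AE => -[P /= PS].
    move/lineP_lin/eqP; rewrite -(slack_eq0 T) slack_seg => /eqP.
    have := xS P PS; have := zS P PS; clear -t0 t1; nra.
  - apply: connected_continuous_connected; first exact: segment_connected.
    exact/continuous_subspaceT/seg_continuous.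
  - exists 1; first by rewrite /= in_itv /= ler01 lexx.
    by rewrite /seg !mul1r ![_ + (_ - _)]addrC !subrK -surjective_pairing.
apply/seteqP; split.
  have -> : cell T S = \bigcap_(P in [set` S]) [set z | 0 <= slack T P z].
    by apply/seteqP; split=> z h P PS; exact: h.
  have cl : closed (\bigcap_(P in [set` S]) [set z | 0 <= slack T P z]).
    apply: closed_bigI => P _.
    apply: (@closed_comp _ _ (slack T P) [set r | 0 <= r]); last exact: closed_ge.
    move=> z _; rewrite /slack; case: (T P); first exact: lin_continuous.
    by apply: cvgN; exact: lin_continuous.
  move/closure_id: cl => ->; apply: closureS => z cz P PS.
  have := component_same_sign _ _ _ _ (sub P PS) cz Ax.
  rewrite /slack /T /=; case: (ltP 0 (lin P x)) => _ h; rewrite ?oppr_ge0; last by rewrite leNgt -h.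
  by rewrite ltW // -h.
move=> y yS B By.
have : \forall t \near (0 : R), B (seg y x t).
  have seg0 : seg y x 0 = y by rewrite /seg !mul0r !addr0 -surjective_pairing.
  by move: By; rewrite -{1}seg0; exact: seg_continuous.
case/nbhs_ballP => e /= e0 eB.
pose t := Num.min (e / 2) 1.
have t0 : 0 < t by rewrite lt_min ltr01 divr_gt0.
have t1 : t <= 1 by rewrite ge_min lexx orbT.
exists (seg y x t); split.
  apply: open_sub => P PS; rewrite slack_seg.
  have := xS P PS; have := yS P PS; move: t0 t1; clear; nra.
apply: eB; rewrite /ball /= sub0r normrN gtr0_norm //.
by rewrite gt_min; apply/orP; left; lra.
Qed.

(** * From cells to polygons *)

Lemma cell_polygon {R : realType} (T : pred (R * R)) (G : seq (R * R)) :
  bounded_plane (cell T G) -> cell T G !=set0 -> uniq G -> (size G <= 4)%N ->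
  exists vs : seq (R * R), (3 <= size vs <= 4)%N /\ cell T G = conv_hull vs.
Proof.
move=> bG [x xG] uG sG; have [V uV VE] := vertex_seq T G.
have hull := cell_sub_hull _ _ V bG (fun v => (VE v).2).
have sV : (size V <= 4)%N.
  by apply: leq_trans sG; apply: (size_vertices T G V uG uV) => v vV; exact: (VE v).1.
case: V {uV} VE hull sV => [|v V] VE hull sV.
  by have [w [_ + _ _]] := hull x xG; rewrite big_ord0 => /eqP; rewrite eq_sym oner_eq0.
(* Copies of [v] bring the list to length three without changing the hull; truncated subtraction
   makes the padding empty for longer lists. *)
pose vs := (v :: V) ++ nseq (3 - size (v :: V)) v.
have vsE u : u \in vs -> u \in v :: V.
  by rewrite mem_cat => /orP[//|/nseqP[-> _]]; rewrite mem_head.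
exists vs; split.
  by rewrite size_cat size_nseq; move: sV => /=; lia.
apply/seteqP; split; last first.
  apply: conv_hull_cell => u /vsE uV; by have [] := (VE u).1 uV.
apply: cell_sub_hull => // u uV; rewrite mem_cat; apply/orP; left; exact: (VE u).2.
Qed.

Theorem theorem4p3 (R : realType) (a b dx dy : R) (N M : nat) :
  (a, b) <> (0, 0) -> 0 < dx -> 0 < dy ->
  (a, b + M%:R * dy) <> (0, 0) ->
  (a + N%:R * dx, b) <> (0, 0) ->
  (a + N%:R * dx, b + M%:R * dy) <> (0, 0) ->
  forall Rg : set (R * R),
    is_region (rect_lattice a b dx dy N M) Rg -> bounded_plane Rg ->
    polygon_at_most_4_sides (rect_lattice a b dx dy N M) Rg.
Proof.
move=> _ dx0 dy0 _ _ _ Rg [x cx ->].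
pose X := [seq a + k%:R * dx | k <- iota 0 N.+1].
pose Y := [seq b + k%:R * dy | k <- iota 0 M.+1].
(* [B] retains the origin when the grid contains it, so that it is a full product as the facet count
   requires; [S] drops it. *)
pose B := [seq (u, v) | u <- X, v <- Y].
pose S := [seq P <- B | P != (0, 0)].
have progE (c d : R) n u : reflect (exists2 k : nat, (k <= n)%N & u = c + k%:R * d)
    (u \in [seq c + k%:R * d | k <- iota 0 n.+1]).
  apply: (iffP mapP) => [[k]|[k kn ->]].
    by rewrite mem_iota => /andP[_ kn] ->; exists k.
  by exists k; rewrite // mem_iota.
have SE : rect_lattice a b dx dy N M = [set` S].
  apply/seteqP; split=> p /=.
    case=> -[k [j [kN jM ->]]] /eqP p0; rewrite mem_filter p0 mem_grid /=.
    by apply/andP; split; apply/progE; [exists k|exists j].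
  rewrite mem_filter mem_grid => /andP[/eqP p0 /andP[/progE[k kN e1] /progE[j jM e2]]].
  by split=> //; exists k, j; split=> //; rewrite [LHS]surjective_pairing e1 e2.
have xS : pattern_complement (rect_lattice a b dx dy N M) x by [].
rewrite (closure_component S) //; last by rewrite /pattern_complement SE.
set T := [pred P | _] => bS.
have xpos P : P \in S -> 0 < slack T P x.
  move=> PS; rewrite lt0r slack_eq0; apply/andP; split.
    apply/negP => /eqP/lineP_lin lx; apply: cx; exists P => //.
    by rewrite SE.
  by rewrite /slack /T /=; case: (ltP 0 (lin P x)) => [/ltW|] //; rewrite oppr_ge0.
(* This bound serves twice: for a minimal set of constraints, which bounds the vertices, and for the
   list of all side lines. *)
have sides (fs : seq (R * R)) : uniq fs ->
    (forall P, P \in fs -> P \in S /\ side_line (cell T S) P) -> (size fs <= 4)%N.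
  move=> ufs fsS.
  have first (c d : R) n : c \in [seq c + k%:R * d | k <- iota 0 n.+1].
    by apply/progE; exists 0%N; rewrite ?mul0r ?addr0.
  have last (c d : R) n : c + n%:R * d \in [seq c + k%:R * d | k <- iota 0 n.+1].
    by apply/progE; exists n.
  have bounds (c d : R) n : 0 < d -> forall u, u \in [seq c + k%:R * d | k <- iota 0 n.+1] ->
      c <= u <= c + n%:R * d.
    move=> d0 u /progE[k kn ->]; rewrite lerDl lerD2l ler_pM2r // ler_nat kn andbT.
    by rewrite mulr_ge0 // ltW.
  apply: (@size_facets R X Y T a (a + N%:R * dx) b (b + M%:R * dy) fs).
  - exact: progression_reflection_closed.
  - exact: progression_reflection_closed.
  - exact: first.
  - exact: last.
  - exact: first.
  - exact: last.
  - exact: (bounds a dx N dx0).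
  - exact: (bounds b dy M dy0).
  - exact: ufs.
  - move=> P /fsS[]; rewrite mem_filter => /andP[P0 PB] sP; split=> //.
    apply: side_line_facet sP => //.
    by rewrite /T /= /lin !mul0r addr0 add0r oppr_gt0 ltr10.
split.
  (* Each constraint in the irredundant subfamily [G] supports a genuine side of the same cell, so
     [G] has at most four members. *)
  have [G [uG GS cG essG]] := essential_subfamily T S.
  have bG : bounded_plane (cell T G) by rewrite cG.
  rewrite -cG; apply: cell_polygon => //.
    by exists x => P /GS/xpos/ltW.
  apply: sides => // P PG; split; first exact: GS.
  have [y yP yG] := essG P PG.
  by rewrite -cG; apply: (@essential_side_line R T G x y) => // Q /GS/xpos.
exists (undup [seq P <- S | `[< side_line (cell T S) P >]]); split.
  apply: sides; first exact: undup_uniq.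
  by move=> P; rewrite mem_undup mem_filter => /andP[/asboolP].
move=> P; rewrite SE /= => PS sP.
by rewrite mem_undup mem_filter PS andbT; apply/asboolP.
Qed.
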